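(* Suppose $f$ is continuous on $[-1,1]$ and the normalized Chebyshev polynomials of the first kind constitute a basis for the space $\mathbb P_L$ of polynomials of degree at most $L$. Let $\lambda\ge 0$ and let $0\le\mu_0\le\mu_1\le\cdots$ be the penalization parameters. Then the Lebesgue constants $\Lambda_L$ for the $\ell_2$-regularized least squares approximation of degree $L$ ($L\ge 2$) on $[-1,1]$ using Chebyshev polynomials of the first kind satisfy $$\Lambda_L=\frac{\frac{4}{\pi^2}\log L}{1+\lambda\tilde\mu^2}+\mathcal O(1)$$ for some $\tilde\mu\in\mathbb R$ (possibly depending on $L$) with $\min\{\mu_0,\dots,\mu_L\}\le\tilde\mu\le\max\{\mu_0,\dots,\mu_L\}$, where $\mathcal O(1)$ is as $L\to\infty$, and $$\Lambda_L\le\frac{\frac{4}{\pi^2}\log(L-1)+\eta}{1+\lambda\underline\mu^2},$$ where $\underline\mu=\min\{\mu_0,\mu_1,\dots,\mu_L\}$ and $\eta=\frac{4}{\pi^2}+\frac2\pi\Bigl(1+\int_0^\pi\frac{\sin x}{x}\,dx\Bigr)=2.220884\ldots$.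
   Context: The Lebesgue constants for $\ell_2$-regularized least squares approximation using Chebyshev polynomials of the first kind are defined as $$\Lambda_L:=\frac1\pi\int_{-\pi}^{\pi}|u_L(t)|\,dt,\qquad u_L(t)=\frac{\rho_{0,L}}{2}+\sum_{\ell=1}^L\rho_{\ell,L}\cos\ell t,\qquad \rho_{\ell,L}=\frac{1}{1+\lambda\mu_\ell^2}\quad(\ell=0,\dots,L).$$ Here $\lambda$ is the regularization parameter and $\{\mu_\ell\}$ is a nonnegative nondecreasing sequence. *)

(* Defs.v *)
From Stdlib Require Import Reals RList List.
From Coquelicot Require Import Coquelicot.
Open Scope R_scope.

Fixpoint chebyshevT (n : nat) (x : R) : R :=
  match n with
  | O => 1
  | S O => x
  | S (S m as k) => 2 * x * chebyshevT k x - chebyshevT m x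
  end.

(* Orthonormal for the weight 1 / sqrt (1 - x^2) on (-1, 1). *)
Definition normalized_chebyshevT (n : nat) (x : R) : R :=
  match n with
  | O => / sqrt PI * chebyshevT 0 x
  | S _ => sqrt (2 / PI) * chebyshevT n x
  end.

Definition in_PL (L : nat) (p : R -> R) : Prop :=
  exists a : nat -> R, forall x, p x = sum_n (fun k => a k * x ^ k) L.

(* The family phi 0, ..., phi L (later terms are ignored). *)
Definition is_basis_PL (L : nat) (phi : nat -> R -> R) : Prop :=
  (forall l, (l <= L)%nat -> in_PL L (phi l)) /\
  (forall c : nat -> R,
     (forall x, sum_n (fun l => c l * phi l x) L = 0) ->
     forall l, (l <= L)%nat -> c l = 0) /\
  (forall p, in_PL L p ->
     exists c : nat -> R, forall x, p x = sum_n (fun l => c l * phi l x) L).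

Definition rho (lambda : R) (mu : nat -> R) (l : nat) : R :=
  1 / (1 + lambda * (mu l) ^ 2).

Definition u (lambda : R) (mu : nat -> R) (L : nat) (t : R) : R :=
  rho lambda mu 0 / 2
  + sum_n_m (fun l => rho lambda mu l * cos (INR l * t)) 1 L.

Definition Lebesgue_constant (lambda : R) (mu : nat -> R) (L : nat) : R :=
  1 / PI * RInt (fun t => Rabs (u lambda mu L t)) (- PI) PI.

Definition min_mu (mu : nat -> R) (L : nat) : R :=
  MinRlist (map mu (seq 0 (S L))).

Definition max_mu (mu : nat -> R) (L : nat) : R :=
  MaxRlist (map mu (seq 0 (S L))).

(* The value of sin x / x at x = 0 does not affect the integral. *)
Definition eta : R :=
  4 / PI ^ 2 + 2 / PI * (1 + RInt (fun x => sin x / x) 0 PI).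

(* Main.v *)
Require Import Defs.
From Stdlib Require Import Arith Reals RList Lra Lia List.
From Coquelicot Require Import Coquelicot.
Open Scope R_scope.

(** Write [D_n = 1/2 + cos t + ... + cos (n t)] for the Dirichlet kernel, and note that
    [rho 0 >= rho 1 >= ... >= rho L > 0]. Everything follows from the two bounds
    [[
      rho L * (4 / PI^2) ln (L + 1) <= Lambda_L
                                    <= rho 0 * ((4 / PI^2) ln (L - 1) + eta).
    ]]

    Upper bound. Summation by parts writes [u_L] as a combination of
    [D_0, ..., D_L] with nonnegative coefficients of sum [rho 0]
    ([RInt_Rabs_cosine_sum_le]), so it suffices to bound the norm of each [D_n]. From
    [D_n(t) = sin (n t) / (2 tan (t/2)) + cos (n t) / 2] and [tan (t/2) >= t/2] one
    gets [|D_n(t)| <= |sin (n t)| / t + |cos (n t)| / 2]. Cutting the integral of the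
    first term at the multiples of [PI / n] gives the sine integral at [PI] plus
    [2 / PI] times a harmonic sum ([RInt_Rabs_dirichlet_le]).

    Lower bound. The integral of [|u_L|] is at least that of [u_L] times the sign
    of [D_L]. Fejer observed that the cosine coefficients of this sign, up to
    degree [L], are positive: the [l]-th one is
    [(2 / (PI l)) * tan (l PI / (2L + 1))] ([alternating_functional_sin]). Therefore
    each [rho l] may be replaced by [rho L]. Elementary bounds for [sin] show that
    the [l]-th coefficient is at least [(8 / PI^2) / (2L + 1 - 2l)], and these sum to
    at least [(4 / PI^2) ln (L + 1)] ([RInt_Rabs_cosine_sum_ge]).

    The effective parameter. Let [q = (4 / PI^2) ln L]. By the lower bound, either
    [Lambda_L] lies between [rho L * q] and [rho 0 * q], and it equals
    [q / (1 + lambda m^2)] for some [m] between [mu 0] and [mu L], or it exceeds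
    [rho 0 * q], by at most [eta] according to the upper bound; then [m = mu 0]
    ([effective_parameter]).

    The numerical value of [eta] comes from integrating alternating Taylor bounds
    for [sin x / x] and from locating [PI] by the sign of [sin] ([eta_bounds]). *)

(** * Sums from 1 to n *)

(** Integrals and sums in an abstract module state equalities at the carrier of its
    structure, which [ring] does not recognize as [R]. *)
Ltac real_eq := match goal with |- ?x = ?y => change (@eq R x y) end.

Lemma sum_from_1_to_0 (a : nat -> R) : sum_n_m a 1 0 = 0.
Proof. exact (sum_n_m_zero a 1 0 (le_n 1)). Qed.

Lemma sum_from_1_to_S (a : nat -> R) n :
  sum_n_m a 1 (S n) = sum_n_m a 1 n + a (S n).
Proof. exact (sum_n_Sm a 1 n (le_n_S 0 n (Nat.le_0_l n))). Qed.

Lemma sum_from_1_scal c (a : nat -> R) n :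
  sum_n_m (fun l => c * a l) 1 n = c * sum_n_m a 1 n.
Proof. exact (sum_n_m_mult_l (K := R_Ring) c a 1 n). Qed.

Lemma sum_from_1_plus (a b : nat -> R) n :
  sum_n_m (fun l => a l + b l) 1 n = sum_n_m a 1 n + sum_n_m b 1 n.
Proof. exact (sum_n_m_plus (G := R_AbelianGroup) a b 1 n). Qed.

Lemma sum_from_1_le (a b : nat -> R) n :
  (forall l, (1 <= l <= n)%nat -> a l <= b l) -> sum_n_m a 1 n <= sum_n_m b 1 n.
Proof.
  induction n as [|n IH]; intros H.
  - rewrite !sum_from_1_to_0; lra.
  - rewrite !sum_from_1_to_S; apply Rplus_le_compat; [apply IH|]; auto with arith.
    intros l Hl; apply H; lia.
Qed.

Lemma sum_from_1_zero (a : nat -> R) n :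
  (forall l, a l = 0) -> sum_n_m a 1 n = 0.
Proof.
  intros H; induction n as [|n IH].
  - apply sum_from_1_to_0.
  - rewrite sum_from_1_to_S, IH, H; apply Rplus_0_l.
Qed.

(** * Cosine sums and their primitives *)

(** [u lambda mu L] is [cosine_sum (rho lambda mu) L] by conversion, and with all
    coefficients 1 this is the Dirichlet kernel; the coefficients are left free so
    that both are handled together. *)
Definition cosine_sum (r : nat -> R) (n : nat) (t : R) : R :=
  r 0%nat / 2 + sum_n_m (fun l => r l * cos (INR l * t)) 1 n.

Lemma cosine_sum_0 r t : cosine_sum r 0 t = r 0%nat / 2.
Proof.
  unfold cosine_sum; rewrite sum_from_1_to_0.
  simpl; ring.
Qed.

Lemma cosine_sum_S r n t :
  cosine_sum r (S n) t = cosine_sum r n t + r (S n) * cos (INR (S n) * t).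
Proof.
  unfold cosine_sum; rewrite sum_from_1_to_S; ring.
Qed.

Lemma cosine_sum_continuous r n t : continuous (cosine_sum r n) t.
Proof.
  induction n as [|n IH].
  - apply continuous_ext with (fun _ => r 0%nat / 2).
    + intros x; now rewrite cosine_sum_0.
    + apply continuous_const.
  - apply continuous_ext with
      (fun x => plus (cosine_sum r n x) (r (S n) * cos (INR (S n) * x))).
    + intros x; rewrite cosine_sum_S; reflexivity.
    + apply (continuous_plus (cosine_sum r n)); [exact IH|].
      apply (ex_derive_continuous (V := R_NormedModule)); auto_derive; exact I.
Qed.

Lemma cosine_sum_even r n t : cosine_sum r n (- t) = cosine_sum r n t.
Proof.
  induction n as [|n IH]; [now rewrite !cosine_sum_0|].
  rewrite !cosine_sum_S, IH.
  replace (INR (S n) * - t) with (- (INR (S n) * t)) by ring.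
  now rewrite cos_neg.
Qed.

Lemma ex_RInt_continuous_everywhere (g : R -> R) a b :
  (forall x, continuous g x) -> ex_RInt g a b.
Proof. intros Hg; apply (ex_RInt_continuous (V := R_CompleteNormedModule)); auto. Qed.

Lemma continuous_Rabs_comp (g : R -> R) x :
  continuous g x -> continuous (fun y => Rabs (g y)) x.
Proof.
  intros Hg; apply (continuous_comp g Rabs); [exact Hg|].
  apply continuous_Rabs.
Qed.

Lemma RInt_even (g : R -> R) a :
  (forall x, continuous g x) -> (forall x, g (- x) = g x) ->
  RInt g (- a) a = 2 * RInt g 0 a.
Proof.
  intros Hc He.
  assert (Hex : forall x y, ex_RInt g x y)
    by (intros; now apply ex_RInt_continuous_everywhere).
  rewrite <- (RInt_Chasles g (- a) 0 a); auto.
  assert (H : RInt g (- a) 0 = RInt g 0 a).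
  { assert (H1 := RInt_comp_lin g (-1) 0 0 a (Hex _ _)).
    replace (-1 * 0 + 0) with 0 in H1 by ring.
    replace (-1 * a + 0) with (- a) in H1 by ring.
    rewrite <- (opp_RInt_swap g) in H1 by auto.
    rewrite (RInt_ext _ (fun y => @opp R_CompleteNormedModule (g y))) in H1.
    - rewrite (RInt_opp (V := R_CompleteNormedModule) g) in H1 by auto.
      unfold opp in H1; simpl in H1; lra.
    - intros y _; unfold scal, opp; simpl; unfold mult; simpl.
      replace (-1 * y + 0) with (- y) by ring; rewrite He; ring. }
  rewrite H; unfold plus; simpl; ring.
Qed.
(** * Lower bound: testing against the sign of the Dirichlet kernel *)

(** On the [j]-th interval between consecutive nodes, [|g|] is bounded below by
    [(-1) ^ j * g], whose integral is an increment of the primitive [G]. The left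
    side is the sum of these increments, regrouped by node: each inner node is an
    endpoint of two intervals of opposite signs, so it counts twice. The upper
    endpoint [b] is free because the last interval is in general cut short. *)
Lemma alternating_increments_le_RInt_Rabs (G g : R -> R) (a : nat -> R) :
  (forall x, is_derive G x (g x)) -> (forall x, continuous g x) ->
  (forall j, a j <= a (S j)) ->
  forall n b, a n <= b ->
  2 * sum_n_m (fun j => (-1) ^ S j * G (a j)) 1 n - G (a 0%nat) + (-1) ^ n * G b
  <= RInt (fun x => Rabs (g x)) (a 0%nat) b.
Proof.
  intros HG Hg Ha.
  assert (Habs : forall x y, ex_RInt (fun x => Rabs (g x)) x y).
  { intros; apply ex_RInt_continuous_everywhere; intros.
    now apply continuous_Rabs_comp. }
  assert (step : forall n x y, x <= y ->
    (-1) ^ n * (G y - G x) <= RInt (fun x => Rabs (g x)) x y).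
  { intros n x y Hxy.
    assert (HI : is_RInt g x y (minus (G y) (G x))).
    { apply (is_RInt_derive (V := R_CompleteNormedModule)); auto. }
    assert (Hle : Rabs (G y - G x) <= RInt (fun x => Rabs (g x)) x y).
    { apply (norm_RInt_le g (fun x => Rabs (g x)) x y (G y - G x)); auto.
      - intros z _; apply Rle_refl.
      - apply (RInt_correct (V := R_CompleteNormedModule)); auto. }
    apply Rle_trans with (2 := Hle).
    apply Rle_trans with (1 := Rle_abs _).
    rewrite Rabs_mult, pow_1_abs; lra. }
  induction n as [|n IH]; intros b Hb.
  - rewrite sum_from_1_to_0.
    specialize (step 0%nat (a 0%nat) b Hb).
    simpl in *; lra.
  - rewrite sum_from_1_to_S.
    rewrite <- (RInt_Chasles _ (a 0%nat) (a (S n)) b); auto.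
    specialize (IH (a (S n)) (Ha n)).
    specialize (step (S n) _ _ Hb).
    unfold plus in *; simpl in *; lra.
Qed.

(** The difference of the two sides vanishes at 0 and has derivative [x * sin x]. It
    gives both the monotonicity of [sin x / x] behind Jordan's inequality and the
    bound [1 / (2 tan (t / 2)) <= 1 / t] for the Dirichlet kernel. *)
Lemma Rmult_cos_le_sin x : 0 <= x <= PI -> x * cos x <= sin x.
Proof.
  intros Hx.
  destruct (MVT_gen (fun y => sin y - y * cos y) 0 x (fun y => y * sin y))
    as [c [Hc Heq]].
  - intros y _; auto_derive; [exact I | ring].
  - intros y _; apply derivable_continuous_pt, ex_derive_Reals_0; auto_derive; exact I.
  - rewrite Rmin_left, Rmax_right in Hc by lra.
    rewrite sin_0 in Heq.
    assert (0 <= sin c) by (apply sin_ge_0; lra).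
    assert (0 <= c * sin c * (x - 0)) by (repeat apply Rmult_le_pos; lra).
    lra.
Qed.

Lemma jordan_inequality y : 0 < y <= PI / 2 -> 2 / PI * y <= sin y.
Proof.
  intros Hy.
  assert (HPI := PI_RGT_0).
  destruct (MVT_gen (fun x => sin x / x) y (PI / 2)
              (fun x => (x * cos x - sin x) / x ^ 2)) as [c [Hc Heq]].
  - rewrite Rmin_left, Rmax_right by lra; intros x Hx; auto_derive; [lra | field; lra].
  - rewrite Rmin_left, Rmax_right by lra; intros x Hx.
    apply derivable_continuous_pt, ex_derive_Reals_0; auto_derive; lra.
  - rewrite Rmin_left, Rmax_right in Hc by lra.
    assert (Hc' := Rmult_cos_le_sin c ltac:(lra)).
    assert (0 <= (sin c - c * cos c) / c ^ 2 * (PI / 2 - y)).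
    { apply Rmult_le_pos; [|lra].
      apply Rdiv_le_0_compat; [lra|]. apply pow_lt; lra. }
    replace ((c * cos c - sin c) / c ^ 2) with (- ((sin c - c * cos c) / c ^ 2)) in Heq
      by (field; lra).
    rewrite sin_PI2 in Heq.
    assert (Hq : 2 / PI <= sin y / y).
    { replace (2 / PI) with (1 / (PI / 2)) by (field; lra). lra. }
    apply Rmult_le_compat_r with (r := y) in Hq; [|lra].
    unfold Rdiv at 2 in Hq; rewrite Rmult_assoc, Rinv_l in Hq; lra.
Qed.

(** Jordan's inequality bounds the numerator of [sin y / cos y], and
    [cos y = sin (PI / 2 - y) <= PI / 2 - y] bounds the denominator. The result has
    the same leading term as [tan] at the pole [PI / 2], which is what makes the
    constant [4 / PI ^ 2] of the logarithm come out exactly. *)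
Lemma tan_ge_rational y : 0 < y < PI / 2 -> 4 * y / (PI * (PI - 2 * y)) <= tan y.
Proof.
  intros Hy.
  assert (HPI := PI_RGT_0).
  assert (Hc : 0 < cos y) by (apply cos_gt_0; lra).
  assert (Hs := jordan_inequality y ltac:(lra)).
  assert (Hc2 : cos y <= PI / 2 - y).
  { rewrite <- sin_shift; left; apply sin_lt_x; lra. }
  apply Rle_trans with (2 / PI * y / (PI / 2 - y)).
  - right; field; lra.
  - unfold tan, Rdiv at 1. apply Rmult_le_compat.
    + apply Rmult_le_pos; [|lra]. apply Rlt_le, Rdiv_lt_0_compat; lra.
    + left; apply Rinv_0_lt_compat; lra.
    + exact Hs.
    + apply Rinv_le_contravar; lra.
Qed.

Definition sine_primitive (r : nat -> R) (n : nat) (t : R) : R :=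
  r 0%nat / 2 * t + sum_n_m (fun l => r l * (sin (INR l * t) / INR l)) 1 n.

Lemma sine_primitive_S r n t :
  sine_primitive r (S n) t
  = sine_primitive r n t + r (S n) * (sin (INR (S n) * t) / INR (S n)).
Proof.
  unfold sine_primitive; rewrite sum_from_1_to_S; ring.
Qed.

Lemma is_derive_sine_primitive r n t :
  is_derive (sine_primitive r n) t (cosine_sum r n t).
Proof.
  induction n as [|n IH].
  - apply is_derive_ext with (fun x => r 0%nat / 2 * x).
    + intros x; unfold sine_primitive; rewrite sum_from_1_to_0.
      simpl; ring.
    + rewrite cosine_sum_0; auto_derive; [exact I | ring].
  - apply is_derive_ext with
      (fun x => plus (sine_primitive r n x) (r (S n) * (sin (INR (S n) * x) / INR (S n)))).
    + intros x; rewrite sine_primitive_S; reflexivity.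
    + rewrite cosine_sum_S.
      apply (is_derive_plus (sine_primitive r n)); [exact IH|].
      assert (HS : INR (S n) <> 0) by (apply not_0_INR; lia).
      set (m := INR (S n)) in *.
      auto_derive; [auto | field; auto].
Qed.

(** Multiplying by [2 * cos (x / 2)] turns each term into
    [(-1) ^ (j + 1) * (sin ((j + 1/2) x) + sin ((j - 1/2) x))], which telescopes. *)
Lemma alternating_sum_sin n x :
  2 * cos (x / 2) * sum_n_m (fun j => (-1) ^ S j * sin (INR j * x)) 1 n
  = sin (x / 2) - (-1) ^ n * sin ((INR n + / 2) * x).
Proof.
  induction n as [|n IH].
  - rewrite sum_from_1_to_0.
    simpl.
    replace ((0 + / 2) * x) with (x / 2) by field; ring.
  - rewrite sum_from_1_to_S.
    rewrite Rmult_plus_distr_l, IH.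
    replace ((INR n + / 2) * x) with (INR (S n) * x - x / 2) by (rewrite S_INR; field).
    replace ((INR (S n) + / 2) * x) with (INR (S n) * x + x / 2) by field.
    rewrite sin_minus, sin_plus.
    simpl pow; ring.
Qed.

Lemma alternating_sum_INR n :
  4 * sum_n_m (fun j => (-1) ^ S j * INR j) 1 n = 1 - (-1) ^ n * (2 * INR n + 1).
Proof.
  induction n as [|n IH].
  - rewrite sum_from_1_to_0. simpl; ring.
  - rewrite sum_from_1_to_S.
    rewrite Rmult_plus_distr_l, IH, S_INR; simpl pow; ring.
Qed.

(** * Comparison of harmonic sums with the logarithm *)

Lemma ln_le_sub_1 x : 0 < x -> ln x <= x - 1.
Proof.
  intros Hx; assert (H := exp_ineq1_le (ln x)); rewrite exp_ln in H; lra.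
Qed.

Lemma ln_succ_sub_bounds x :
  0 < x -> / (x + 1) <= ln (x + 1) - ln x <= / x.
Proof.
  intros Hx; split.
  - rewrite <- Ropp_minus_distr, <- ln_div by lra.
    assert (H := ln_le_sub_1 (x / (x + 1)) ltac:(apply Rdiv_lt_0_compat; lra)).
    replace (x / (x + 1) - 1) with (- / (x + 1)) in H by (field; lra); lra.
  - rewrite <- ln_div by lra.
    assert (H := ln_le_sub_1 ((x + 1) / x) ltac:(apply Rdiv_lt_0_compat; lra)).
    replace ((x + 1) / x - 1) with (/ x) in H by (field; lra); lra.
Qed.

(** The denominators are the odd numbers [2n-1, ..., 3, 1], in the order in which the
    tangents produce them; the induction therefore splits off the first term. *)
Lemma odd_harmonic_ge_ln n :
  / 2 * ln (INR (S n)) <= sum_n_m (fun l => / (2 * INR n + 1 - 2 * INR l)) 1 n.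
Proof.
  induction n as [|n IH].
  - rewrite sum_from_1_to_0; simpl; rewrite ln_1; lra.
  - rewrite (sum_Sn_m (G := R_AbelianGroup)) by lia.
    rewrite <- sum_n_m_S.
    rewrite (sum_n_m_ext _ (fun l => / (2 * INR n + 1 - 2 * INR l))).
    2:{ intros l; f_equal; rewrite !S_INR; ring. }
    unfold plus; simpl AbelianMonoid.plus.
    assert (Hn := pos_INR n).
    assert (H := proj2 (ln_succ_sub_bounds (INR (S n)) ltac:(rewrite S_INR; lra))).
    assert (/ (2 * INR (S n)) <= / (2 * INR (S n) + 1 - 2 * INR 1)).
    { rewrite S_INR; simpl INR; apply Rinv_le_contravar; lra. }
    rewrite Rinv_mult in H0.
    rewrite (S_INR (S n)).
    match goal with |- _ <= ?X => change X with
      (/ (2 * INR (S n) + 1 - 2 * INR 1) + sum_n_m (fun l => / (2 * INR n + 1 - 2 * INR l)) 1 n) end.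
    lra.
Qed.

(** * Fejer's evaluation of the test functional *)

(** For a primitive [G] vanishing at the first node, this is the integral of [G'] times
    the step function that alternates between 1 and -1 at the nodes [a] and stops at
    [b]. *)
Definition alternating_functional (a : nat -> R) (n : nat) (b : R) (G : R -> R) : R :=
  2 * sum_n_m (fun j => (-1) ^ S j * G (a j)) 1 n + (-1) ^ n * G b.

Lemma alternating_functional_linear a n b F c K :
  alternating_functional a n b (fun t => F t + c * K t)
  = alternating_functional a n b F + c * alternating_functional a n b K.
Proof.
  unfold alternating_functional.
  rewrite <- sum_from_1_scal, (sum_n_m_ext _
    (fun j => 2 * ((-1) ^ S j * F (a j)) + c * (2 * ((-1) ^ S j * K (a j))))).
  2:{ intros j; simpl; ring. }
  rewrite sum_from_1_plus, !sum_from_1_scal; ring.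
Qed.

Lemma alternating_functional_ext a n b F K :
  (forall t, F t = K t) -> alternating_functional a n b F = alternating_functional a n b K.
Proof.
  intros H; unfold alternating_functional; rewrite H; do 2 f_equal.
  apply sum_n_m_ext; intros j; now rewrite H.
Qed.

(** The nonnegative zeros of [sin ((n + 1/2) t)]: with [b = PI] the alternating step
    function is the sign of the Dirichlet kernel of degree [n]. *)
Definition dirichlet_node (n j : nat) : R := INR j * (2 * PI / (2 * INR n + 1)).

Lemma alternating_functional_id n :
  alternating_functional (dirichlet_node n) n PI (fun t => t) = PI / (2 * INR n + 1).
Proof.
  assert (Hn := pos_INR n).
  unfold alternating_functional, dirichlet_node.
  rewrite (sum_n_m_ext _
    (fun j => 2 * PI / (2 * INR n + 1) * ((-1) ^ S j * INR j))).
  2:{ intros j; simpl; field; lra. }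
  rewrite sum_from_1_scal.
  assert (H := alternating_sum_INR n).
  set (S := sum_n_m _ 1 n) in *.
  replace S with ((1 - (-1) ^ n * (2 * INR n + 1)) / 4) by lra.
  field; lra.
Qed.

(** Up to the factor [2 / (PI l)], this is Fejer's value of the [l]-th cosine coefficient
    of the sign of the Dirichlet kernel. It is positive for [l <= n], and this is what allows replacing all the
    coefficients of a cosine sum by their minimum in a lower bound. *)
Lemma alternating_functional_sin n l :
  (1 <= l <= n)%nat ->
  alternating_functional (dirichlet_node n) n PI (fun t => sin (INR l * t))
  = tan (INR l * PI / (2 * INR n + 1)).
Proof.
  intros Hl.
  assert (HPI := PI_RGT_0).
  assert (H1 : 1 <= INR l) by (apply (le_INR 1); lia).
  assert (H2 : INR l <= INR n) by (apply le_INR; lia).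
  set (N := 2 * INR n + 1) in *.
  assert (HN : 3 <= N) by (unfold N; lra).
  assert (Hsl : sin (INR l * PI) = 0).
  { apply sin_eq_0_1; exists (Z.of_nat l); now rewrite INR_IZR_INZ. }
  assert (Hy : 0 < INR l * PI / N < PI / 2).
  { split; [apply Rdiv_lt_0_compat; nra|].
    apply Rmult_lt_reg_r with N; [lra|].
    replace (INR l * PI / N * N) with (INR l * PI) by (field; lra).
    unfold N; nra. }
  assert (Hc : 0 < cos (INR l * PI / N)) by (apply cos_gt_0; lra).
  assert (H := alternating_sum_sin n (2 * (INR l * PI / N))).
  replace (2 * (INR l * PI / N) / 2) with (INR l * PI / N) in H by (field; lra).
  replace ((INR n + / 2) * (2 * (INR l * PI / N))) with (INR l * PI) in H
    by (unfold N in *; field; lra).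
  rewrite Hsl in H.
  unfold alternating_functional; rewrite Hsl.
  rewrite (sum_n_m_ext _ (fun j => (-1) ^ S j * sin (INR j * (2 * (INR l * PI / N))))).
  2:{ intros j; unfold dirichlet_node; fold N; do 2 f_equal; field; lra. }
  unfold tan; rewrite Rmult_0_r, Rplus_0_r.
  apply Rmult_eq_reg_l with (cos (INR l * PI / N)); [|lra].
  rewrite <- Rmult_assoc, (Rmult_comm (cos _) 2), H; field; lra.
Qed.

Lemma alternating_functional_sine_primitive r n m :
  (m <= n)%nat ->
  alternating_functional (dirichlet_node n) n PI (sine_primitive r m)
  = r 0%nat / 2 * (PI / (2 * INR n + 1))
    + sum_n_m (fun l => r l * (tan (INR l * PI / (2 * INR n + 1)) / INR l)) 1 m.
Proof.
  induction m as [|m IH]; intros Hm.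
  - rewrite sum_from_1_to_0, Rplus_0_r.
    rewrite (alternating_functional_ext _ _ _ _ (fun t => 0 + r 0%nat / 2 * t)).
    2:{ intros t; unfold sine_primitive; rewrite sum_from_1_to_0; ring. }
    rewrite alternating_functional_linear, alternating_functional_id.
    unfold alternating_functional at 1.
    rewrite sum_from_1_zero by (intros; ring); ring.
  - rewrite sum_from_1_to_S.
    assert (HS : INR (S m) <> 0) by (apply not_0_INR; lia).
    rewrite (alternating_functional_ext _ _ _ _
      (fun t => sine_primitive r m t + r (S m) / INR (S m) * sin (INR (S m) * t))).
    2:{ intros t; rewrite sine_primitive_S; field; auto. }
    rewrite alternating_functional_linear, alternating_functional_sin, IH by lia.
    field; auto.
    split; auto. assert (H := pos_INR n); lra.
Qed.

(** The integral is at least the sum of [r l * tan (l PI / (2n+1)) / l]. With [r l]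
    replaced by [c] and the tangents by their rational lower bounds, the [l]-th term
    becomes [c * (4 / PI) / (2n + 1 - 2l)], and the odd harmonic sum is at least
    [ln (n + 1) / 2]. *)
Lemma RInt_Rabs_cosine_sum_ge r c n :
  0 <= c -> (forall l, (l <= n)%nat -> c <= r l) ->
  c * (2 / PI * ln (INR (S n))) <= RInt (fun t => Rabs (cosine_sum r n t)) 0 PI.
Proof.
  intros Hc Hr.
  assert (HPI := PI_RGT_0).
  assert (Hn := pos_INR n).
  assert (Hnode : forall j, dirichlet_node n j <= dirichlet_node n (S j)).
  { intros j; unfold dirichlet_node; rewrite S_INR.
    assert (0 < 2 * PI / (2 * INR n + 1)) by (apply Rdiv_lt_0_compat; lra). lra. }
  assert (Hlast : dirichlet_node n n <= PI).
  { unfold dirichlet_node; apply Rmult_le_reg_r with (2 * INR n + 1); [lra|].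
    replace (INR n * (2 * PI / (2 * INR n + 1)) * (2 * INR n + 1))
      with (INR n * (2 * PI)) by (field; lra). nra. }
  assert (H := alternating_increments_le_RInt_Rabs _ _ (dirichlet_node n)
    (is_derive_sine_primitive r n) (cosine_sum_continuous r n) Hnode n PI Hlast).
  assert (Hz : dirichlet_node n 0 = 0) by (unfold dirichlet_node; simpl; ring).
  rewrite Hz in H.
  assert (Hp0 : sine_primitive r n 0 = 0).
  { unfold sine_primitive.
    rewrite sum_from_1_zero; [ring|].
    intros l; rewrite Rmult_0_r, sin_0; unfold Rdiv; ring. }
  rewrite Hp0, Rminus_0_r in H.
  apply Rle_trans with (2 := H); clear H.
  change (c * (2 / PI * ln (INR (S n)))
    <= alternating_functional (dirichlet_node n) n PI (sine_primitive r n)).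
  rewrite alternating_functional_sine_primitive by lia.
  assert (H0 : 0 <= r 0%nat / 2 * (PI / (2 * INR n + 1))).
  { specialize (Hr 0%nat ltac:(lia)).
    apply Rmult_le_pos; [lra|]. apply Rdiv_le_0_compat; lra. }
  assert (Hsum : 4 / PI * c * sum_n_m (fun l => / (2 * INR n + 1 - 2 * INR l)) 1 n
    <= sum_n_m (fun l => r l * (tan (INR l * PI / (2 * INR n + 1)) / INR l)) 1 n).
  { rewrite <- sum_from_1_scal; apply sum_from_1_le; intros l Hl.
    assert (H1 : 1 <= INR l) by (apply (le_INR 1); lia).
    assert (H2 : INR l <= INR n) by (apply le_INR; lia).
    set (N := 2 * INR n + 1) in *.
    assert (HN : 0 < N - 2 * INR l) by (unfold N; lra).
    assert (Hy : 0 < INR l * PI / N < PI / 2).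
    { split; [apply Rdiv_lt_0_compat; nra|].
      apply Rmult_lt_reg_r with N; [lra|].
      replace (INR l * PI / N * N) with (INR l * PI) by (field; lra). nra. }
    assert (Ht := tan_ge_rational _ Hy).
    apply Rle_trans with (c * (4 / PI * / (N - 2 * INR l))); [right; ring|].
    apply Rmult_le_compat; [lra | | apply Hr; lia |].
    - apply Rmult_le_pos; [apply Rlt_le, Rdiv_lt_0_compat; lra|].
      left; now apply Rinv_0_lt_compat.
    - apply Rmult_le_reg_r with (INR l); [lra|].
      replace (tan (INR l * PI / N) / INR l * INR l) with (tan (INR l * PI / N))
        by (field; lra).
      apply Rle_trans with (2 := Ht); right; field; repeat split; try lra.
      replace (PI * N - 2 * (INR l * PI)) with (PI * (N - 2 * INR l)) by ring.
      apply Rmult_integral_contrapositive; lra. }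
  assert (Ho := odd_harmonic_ge_ln n).
  assert (Hk : 0 <= 4 / PI * c)
    by (apply Rmult_le_pos; [apply Rlt_le, Rdiv_lt_0_compat|]; lra).
  apply Rmult_le_compat_l with (1 := Hk) in Ho.
  replace (c * (2 / PI * ln (INR (S n)))) with (4 / PI * c * (/ 2 * ln (INR (S n))))
    by (field; lra).
  lra.
Qed.

(** * Upper bound: the norm of the Dirichlet kernel *)

(** The continuous extension of [sin x / x], so that integrability on intervals
    containing 0 follows from continuity. *)
Definition sinc (x : R) : R := if Req_EM_T x 0 then 1 else sin x / x.

Lemma sinc_neq0 x : x <> 0 -> sinc x = sin x / x.
Proof. intros Hx; unfold sinc; now destruct (Req_EM_T x 0). Qed.

Lemma sinc_continuous x : continuous sinc x.
Proof.
  destruct (Req_EM_T x 0) as [->|Hx].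
  - assert (H := is_lim_sinc_0).
    apply (is_lim_ext_loc _ sinc) in H.
    + replace 1 with (sinc 0) in H
        by (unfold sinc; destruct (Req_EM_T 0 0); [reflexivity | lra]).
      apply continuity_pt_filterlim, continuity_pt_filterlim'.
      exact H.
    + exists (mkposreal 1 Rlt_0_1); intros y _ Hy; now rewrite sinc_neq0.
  - apply (continuous_ext_loc _ (fun y => sin y / y)).
    + assert (Hp : 0 < Rabs x) by now apply Rabs_pos_lt.
      exists (mkposreal _ Hp); intros y Hy; rewrite sinc_neq0; [reflexivity|].
      intros ->; revert Hy; unfold ball; simpl; unfold AbsRing_ball, abs, minus, plus, opp; simpl.
      replace (0 + - x) with (- x) by ring; rewrite Rabs_Ropp; lra.
    + apply (ex_derive_continuous (V := R_NormedModule)); auto_derive; auto.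
Qed.

Lemma Rabs_sinc_continuous x : continuous (fun y => Rabs (sinc y)) x.
Proof. apply continuous_Rabs_comp, sinc_continuous. Qed.

Lemma RInt_Rabs_sinc_0_PI :
  RInt (fun x => Rabs (sinc x)) 0 PI = RInt (fun x => sin x / x) 0 PI.
Proof.
  assert (HPI := PI_RGT_0).
  apply (RInt_ext (V := R_CompleteNormedModule)); intros x.
  rewrite Rmin_left, Rmax_right by lra; intros Hx.
  rewrite sinc_neq0 by lra.
  apply Rabs_pos_eq, Rdiv_le_0_compat; [apply sin_ge_0|]; lra.
Qed.

Lemma Rabs_sin_add_PI x : Rabs (sin (x + PI)) = Rabs (sin x).
Proof. now rewrite neg_sin, Rabs_Ropp. Qed.

Lemma Rabs_cos_add_PI x : Rabs (cos (x + PI)) = Rabs (cos x).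
Proof. now rewrite neg_cos, Rabs_Ropp. Qed.

Lemma RInt_period_shift (g : R -> R) p :
  (forall x, continuous g x) -> (forall x, g (x + p) = g x) ->
  forall k : nat, RInt g (INR k * p) (INR (S k) * p) = RInt g 0 p.
Proof.
  intros Hc Hp k.
  assert (Hpk : forall x, g (x + INR k * p) = g x).
  { intros x; induction k as [|k IH].
    - simpl; f_equal; ring.
    - rewrite S_INR, <- IH.
      replace (x + (INR k + 1) * p) with (x + INR k * p + p) by ring.
      apply Hp. }
  assert (H := RInt_comp_lin g 1 (INR k * p) 0 p
    (ex_RInt_continuous_everywhere g _ _ Hc)).
  replace (1 * 0 + INR k * p) with (INR k * p) in H by ring.
  replace (1 * p + INR k * p) with (INR (S k) * p) in H by (rewrite S_INR; ring).
  rewrite <- H.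
  apply (RInt_ext (V := R_CompleteNormedModule)); intros x _.
  unfold scal; simpl; unfold mult; simpl; rewrite !Rmult_1_l; apply Hpk.
Qed.

Lemma RInt_of_derive (G g : R -> R) a b :
  (forall x, is_derive G x (g x)) -> (forall x, continuous g x) ->
  RInt g a b = G b - G a.
Proof.
  intros HG Hg; apply (is_RInt_unique (V := R_CompleteNormedModule)).
  apply (is_RInt_derive (V := R_CompleteNormedModule)); auto.
Qed.

Lemma RInt_sin a b : RInt sin a b = cos a - cos b.
Proof.
  rewrite (RInt_of_derive (fun x => - cos x)); [real_eq; ring | |].
  - intros x; auto_derive; [exact I | ring].
  - apply continuous_sin.
Qed.

Lemma RInt_cos a b : RInt cos a b = sin b - sin a.
Proof.
  apply RInt_of_derive; [|apply continuous_cos].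
  intros x; auto_derive; [exact I | ring].
Qed.

Lemma RInt_Rabs_sin_0_PI : RInt (fun x => Rabs (sin x)) 0 PI = 2.
Proof.
  assert (HPI := PI_RGT_0).
  rewrite (RInt_ext _ sin).
  - rewrite RInt_sin, cos_0, cos_PI; real_eq; ring.
  - rewrite Rmin_left, Rmax_right by lra; intros x Hx.
    apply Rabs_pos_eq, sin_ge_0; lra.
Qed.

Lemma Rabs_cos_continuous x : continuous (fun y => Rabs (cos y)) x.
Proof. apply continuous_Rabs_comp, continuous_cos. Qed.

Lemma Rabs_sin_continuous x : continuous (fun y => Rabs (sin y)) x.
Proof. apply continuous_Rabs_comp, continuous_sin. Qed.

Lemma RInt_Rabs_cos_0_PI : RInt (fun x => Rabs (cos x)) 0 PI = 2.
Proof.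
  assert (HPI := PI_RGT_0).
  rewrite <- (RInt_Chasles _ 0 (PI / 2) PI);
    try (apply ex_RInt_continuous_everywhere, Rabs_cos_continuous).
  rewrite (RInt_ext (fun x => Rabs (cos x)) cos 0 (PI / 2)).
  2:{ rewrite Rmin_left, Rmax_right by lra; intros x Hx.
      apply Rabs_pos_eq, cos_ge_0; lra. }
  rewrite (RInt_ext (fun x => Rabs (cos x)) (fun x => - cos x) (PI / 2) PI).
  2:{ rewrite Rmin_left, Rmax_right by lra; intros x Hx.
      apply Rabs_left1, cos_le_0; lra. }
  rewrite RInt_cos, (RInt_of_derive (fun x => - sin x) (fun x => - cos x)).
  - rewrite sin_0, sin_PI, sin_PI2; unfold plus; simpl; real_eq; ring.
  - intros x; auto_derive; [exact I | ring].
  - intros x; apply (ex_derive_continuous (V := R_NormedModule)); auto_derive; exact I.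
Qed.

Lemma RInt_Rabs_cos_multiple n : RInt (fun x => Rabs (cos x)) 0 (INR n * PI) = 2 * INR n.
Proof.
  induction n as [|n IH].
  - simpl; rewrite Rmult_0_l, RInt_point; unfold zero; simpl; real_eq; ring.
  - rewrite <- (RInt_Chasles _ 0 (INR n * PI));
      try (apply ex_RInt_continuous_everywhere, Rabs_cos_continuous).
    rewrite IH, (RInt_period_shift (fun x => Rabs (cos x)) PI Rabs_cos_continuous Rabs_cos_add_PI).
    rewrite RInt_Rabs_cos_0_PI, S_INR; unfold plus; simpl; real_eq; ring.
Qed.

(** For [k >= 1] and [k PI <= x <= (k+1) PI] the denominator is at least [k PI], and
    [|sin|] has integral 2 over a period. The first interval is kept exactly; it is
    the sine integral in [eta]. *)
Lemma RInt_Rabs_sinc_multiple_le n :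
  RInt (fun x => Rabs (sinc x)) 0 (INR (S n) * PI)
  <= RInt (fun x => sin x / x) 0 PI + 2 / PI * sum_n_m (fun k => / INR k) 1 n.
Proof.
  assert (HPI := PI_RGT_0).
  induction n as [|n IH].
  - rewrite sum_from_1_to_0; simpl; rewrite Rmult_1_l, RInt_Rabs_sinc_0_PI; lra.
  - rewrite <- (RInt_Chasles _ 0 (INR (S n) * PI));
      try (apply ex_RInt_continuous_everywhere, Rabs_sinc_continuous).
    rewrite sum_from_1_to_S.
    assert (Hn : 0 < INR (S n)) by (apply lt_0_INR; lia).
    assert (Hlen : INR (S n) * PI <= INR (S (S n)) * PI).
    { rewrite (S_INR (S n)); nra. }
    assert (H : RInt (fun x => Rabs (sinc x)) (INR (S n) * PI) (INR (S (S n)) * PI)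
      <= RInt (fun x => / (INR (S n) * PI) * Rabs (sin x))
           (INR (S n) * PI) (INR (S (S n)) * PI)).
    { apply RInt_le; [exact Hlen | | |].
      - apply ex_RInt_continuous_everywhere, Rabs_sinc_continuous.
      - apply ex_RInt_continuous_everywhere; intros x.
        apply (continuous_scal_r (V := R_NormedModule)), Rabs_sin_continuous.
      - intros x Hx.
        assert (Hp : 0 < INR (S n) * PI) by nra.
        rewrite sinc_neq0, Rabs_div, (Rabs_pos_eq x) by lra.
        unfold Rdiv; rewrite Rmult_comm; apply Rmult_le_compat_r; [apply Rabs_pos|].
        apply Rinv_le_contravar; lra. }
    rewrite (RInt_scal (V := R_CompleteNormedModule) (fun x => Rabs (sin x))) in H
      by apply ex_RInt_continuous_everywhere, Rabs_sin_continuous.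
    rewrite (RInt_period_shift (fun x => Rabs (sin x)) PI Rabs_sin_continuous Rabs_sin_add_PI) in H.
    rewrite RInt_Rabs_sin_0_PI in H.
    change (scal ?a 2) with (a * 2) in H.
    change (plus ?a ?b) with (a + b).
    replace (/ (INR (S n) * PI) * 2) with (2 / PI * / INR (S n)) in H
      by (field; lra).
    lra.
Qed.

Lemma harmonic_le_ln n : sum_n_m (fun k => / INR k) 1 (S n) <= 1 + ln (INR (S n)).
Proof.
  induction n as [|n IH].
  - rewrite sum_from_1_to_S, sum_from_1_to_0; simpl; rewrite ln_1; lra.
  - rewrite sum_from_1_to_S.
    assert (Hn : 0 < INR (S n)) by (apply lt_0_INR; lia).
    assert (H := proj1 (ln_succ_sub_bounds _ Hn)).
    rewrite (S_INR (S n)); lra.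
Qed.

Lemma dirichlet_closed_form n t :
  2 * sin (t / 2) * cosine_sum (fun _ => 1) n t
  = sin (INR n * t) * cos (t / 2) + cos (INR n * t) * sin (t / 2).
Proof.
  rewrite <- sin_plus.
  induction n as [|n IH].
  - rewrite cosine_sum_0; simpl; rewrite Rmult_0_l, Rplus_0_l; field.
  - rewrite cosine_sum_S, Rmult_plus_distr_l, IH.
    replace (INR n * t + t / 2) with (INR (S n) * t - t / 2) by (rewrite S_INR; field).
    rewrite sin_minus, sin_plus; ring.
Qed.

(** For [0 < t < PI], the closed form reads
    [D_n(t) = sin (n t) / (2 tan (t / 2)) + cos (n t) / 2], and
    [tan (t / 2) >= t / 2]. *)
Lemma Rabs_dirichlet_le n t :
  (1 <= n)%nat -> 0 < t < PI ->
  Rabs (cosine_sum (fun _ => 1) n t)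
  <= INR n * Rabs (sinc (INR n * t)) + / 2 * Rabs (cos (INR n * t)).
Proof.
  intros Hn Ht.
  assert (HPI := PI_RGT_0).
  assert (Hn1 : 1 <= INR n) by (apply (le_INR 1); lia).
  assert (Hs : 0 < sin (t / 2)) by (apply sin_gt_0; lra).
  assert (Hc : 0 < cos (t / 2)) by (apply cos_gt_0; lra).
  assert (Hcs := Rmult_cos_le_sin (t / 2) ltac:(lra)).
  replace (cosine_sum (fun _ => 1) n t)
    with (sin (INR n * t) * (cos (t / 2) / (2 * sin (t / 2))) + / 2 * cos (INR n * t)).
  2:{ apply Rmult_eq_reg_l with (2 * sin (t / 2)); [|lra].
      rewrite dirichlet_closed_form; field; lra. }
  rewrite sinc_neq0 by nra.
  apply Rle_trans with (1 := Rabs_triang _ _).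
  apply Rplus_le_compat.
  - rewrite Rabs_div by nra.
    rewrite Rabs_mult, (Rabs_pos_eq (INR n * t)) by nra.
    replace (INR n * (Rabs (sin (INR n * t)) / (INR n * t)))
      with (Rabs (sin (INR n * t)) * / t) by (field; lra).
    apply Rmult_le_compat_l; [apply Rabs_pos|].
    rewrite Rabs_pos_eq by (apply Rlt_le, Rdiv_lt_0_compat; lra).
    apply Rmult_le_reg_r with (2 * sin (t / 2) * t); [nra|].
    replace (cos (t / 2) / (2 * sin (t / 2)) * (2 * sin (t / 2) * t))
      with (t * cos (t / 2)) by (field; lra).
    replace (/ t * (2 * sin (t / 2) * t)) with (2 * sin (t / 2)) by (field; lra).
    lra.
  - rewrite Rabs_mult, (Rabs_pos_eq (/ 2)) by lra; lra.
Qed.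

Lemma RInt_dilate (g : R -> R) c b :
  (forall x, continuous g x) -> RInt (fun t => c * g (c * t)) 0 b = RInt g 0 (c * b).
Proof.
  intros Hg.
  assert (H := RInt_comp_lin g c 0 0 b (ex_RInt_continuous_everywhere g _ _ Hg)).
  replace (c * 0 + 0) with 0 in H by ring.
  replace (c * b + 0) with (c * b) in H by ring.
  rewrite <- H; apply (RInt_ext (V := R_CompleteNormedModule)); intros x _.
  unfold scal; simpl; unfold mult; simpl; now rewrite Rplus_0_r.
Qed.

(** After the dilation [x = n t], the two terms of the pointwise bound integrate over
    [0 <= x <= n PI] to a truncated sine integral and to the integral of [|cos|]. *)
Lemma RInt_Rabs_dirichlet_le n :
  RInt (fun t => Rabs (cosine_sum (fun _ => 1) (S n) t)) 0 PI
  <= RInt (fun x => sin x / x) 0 PI + 1 + 2 / PI * sum_n_m (fun k => / INR k) 1 n.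
Proof.
  assert (HPI := PI_RGT_0).
  assert (HN : 0 < INR (S n)) by (apply lt_0_INR; lia).
  set (N := INR (S n)) in *.
  assert (Hlin : forall x, continuous (fun t => N * t) x).
  { intros x; apply (ex_derive_continuous (V := R_NormedModule)); auto_derive; exact I. }
  assert (Hc1 : forall x, continuous (fun t => N * Rabs (sinc (N * t))) x).
  { intros x; apply (continuous_scal_r (V := R_NormedModule)).
    apply (continuous_comp (fun t => N * t) (fun y => Rabs (sinc y))); [apply Hlin|].
    apply Rabs_sinc_continuous. }
  assert (Hc2 : forall x, continuous (fun t => N * Rabs (cos (N * t))) x).
  { intros x; apply (continuous_scal_r (V := R_NormedModule)).
    apply (continuous_comp (fun t => N * t) (fun y => Rabs (cos y))); [apply Hlin|].
    apply Rabs_cos_continuous. }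
  (* The factor [N] is put inside so that the cosine term is a dilation as well. *)
  assert (Hc3 : forall x, continuous (fun t => / (2 * N) * (N * Rabs (cos (N * t)))) x).
  { intros x; apply (continuous_scal_r (V := R_NormedModule)), Hc2. }
  assert (H : RInt (fun t => Rabs (cosine_sum (fun _ => 1) (S n) t)) 0 PI
    <= RInt (fun t => N * Rabs (sinc (N * t)) + / (2 * N) * (N * Rabs (cos (N * t)))) 0 PI).
  { apply RInt_le; [lra | | |].
    - apply ex_RInt_continuous_everywhere; intros x.
      apply continuous_Rabs_comp, cosine_sum_continuous.
    - apply ex_RInt_continuous_everywhere; intros x.
      apply (continuous_plus (V := R_NormedModule)); auto.
    - intros t Ht.
      replace (/ (2 * N) * (N * Rabs (cos (N * t)))) with (/ 2 * Rabs (cos (N * t)))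
        by (field; lra).
      apply Rabs_dirichlet_le; [lia | exact Ht]. }
  rewrite (RInt_plus (V := R_CompleteNormedModule)
     (fun t => N * Rabs (sinc (N * t))) (fun t => / (2 * N) * (N * Rabs (cos (N * t))))) in H
    by now apply ex_RInt_continuous_everywhere.
  rewrite (RInt_scal (V := R_CompleteNormedModule) (fun t => N * Rabs (cos (N * t)))) in H
    by now apply ex_RInt_continuous_everywhere.
  rewrite (RInt_dilate (fun y => Rabs (sinc y)) N PI Rabs_sinc_continuous) in H.
  rewrite (RInt_dilate (fun y => Rabs (cos y)) N PI Rabs_cos_continuous) in H.
  unfold N in H; rewrite RInt_Rabs_cos_multiple in H; fold N in H.
  assert (H' := RInt_Rabs_sinc_multiple_le n); fold N in H'.
  change (scal ?a ?b) with (a * b) in H.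
  change (plus ?a ?b) with (a + b) in H.
  replace (/ (2 * N) * (2 * N)) with 1 in H by (field; lra).
  lra.
Qed.

(** Summation by parts writes the cosine sum as a combination of the Dirichlet kernels
    [D_l] with coefficients [r l - r (l+1)] for [l < n] and [r n] for [l = n]. These
    are nonnegative and add up to [r 0]. *)
Lemma RInt_Rabs_cosine_sum_le r n B :
  (forall l, (l < n)%nat -> r (S l) <= r l) -> 0 <= r n ->
  (forall l, (l <= n)%nat ->
     RInt (fun t => Rabs (cosine_sum (fun _ => 1) l t)) 0 PI <= B) ->
  RInt (fun t => Rabs (cosine_sum r n t)) 0 PI <= r 0%nat * B.
Proof.
  intros Hr Hn HB.
  assert (HPI := PI_RGT_0).
  set (D := cosine_sum (fun _ => 1)) in *.
  assert (Hex : forall (g : R -> R), (forall x, continuous g x) ->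
     ex_RInt (fun t => Rabs (g t)) 0 PI).
  { intros g Hg; apply ex_RInt_continuous_everywhere; intros x.
    now apply continuous_Rabs_comp. }
  assert (Hcomb : forall (f g : R -> R) c, 0 <= c ->
     (forall x, continuous f x) -> (forall x, continuous g x) ->
     RInt (fun t => Rabs (f t + c * g t)) 0 PI
     <= RInt (fun t => Rabs (f t)) 0 PI + c * RInt (fun t => Rabs (g t)) 0 PI).
  { intros f g c Hc Hf Hg.
    rewrite <- (RInt_scal (V := R_CompleteNormedModule) (fun t => Rabs (g t))) by auto.
    rewrite <- (RInt_plus (V := R_CompleteNormedModule) (fun t => Rabs (f t))
       (fun t => scal c (Rabs (g t)))); auto.
    2:{ apply (ex_RInt_scal (V := R_NormedModule)); auto. }
    apply RInt_le; [lra | | |].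
    - apply Hex; intros x; apply (continuous_plus (V := R_NormedModule)); auto.
      apply (continuous_scal_r (V := R_NormedModule)); auto.
    - apply (ex_RInt_plus (V := R_NormedModule)); auto.
      apply (ex_RInt_scal (V := R_NormedModule)); auto.
    - intros t _. apply Rle_trans with (1 := Rabs_triang _ _).
      rewrite Rabs_mult, (Rabs_pos_eq c) by exact Hc. apply Rle_refl. }
  assert (HD : forall m x, continuous (D m) x) by (intros; apply cosine_sum_continuous).
  assert (Hdiff : forall m x, continuous (fun t => cosine_sum r m t + - r m * D m t) x).
  { intros m x; apply (continuous_plus (V := R_NormedModule)).
    - apply cosine_sum_continuous.
    - apply (continuous_scal_r (V := R_NormedModule)), HD. }
  (* Removing [r m * D m] leaves the kernels of degree less than [m], which is stable
     under induction: the next step adds [(r m - r (m+1)) * D m]. *)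
  assert (Hind : forall m, (m <= n)%nat ->
     RInt (fun t => Rabs (cosine_sum r m t + - r m * D m t)) 0 PI <= (r 0%nat - r m) * B).
  { induction m as [|m IH]; intros Hm.
    - rewrite (RInt_ext _ (fun _ => 0)).
      + rewrite RInt_const; unfold scal; simpl; unfold mult; simpl; lra.
      + intros x _; unfold D; rewrite !cosine_sum_0.
        replace (r 0%nat / 2 + - r 0%nat * (1 / 2)) with 0 by field; apply Rabs_R0.
    - rewrite (RInt_ext _ (fun t => Rabs
         ((cosine_sum r m t + - r m * D m t) + (r m - r (S m)) * D m t))).
      2:{ intros x _; unfold D; rewrite !cosine_sum_S; f_equal; ring. }
      specialize (Hr m ltac:(lia)); specialize (HB m ltac:(lia)).
      specialize (IH ltac:(lia)).
      apply Rle_trans with (1 := Hcomb (fun t => cosine_sum r m t + - r m * D m t)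
        (D m) (r m - r (S m)) ltac:(lra) (Hdiff m) (HD m)).
      apply Rmult_le_compat_l with (r := r m - r (S m)) in HB; [|lra].
      lra. }
  specialize (Hind n (le_n n)); specialize (HB n (le_n n)).
  rewrite (RInt_ext _ (fun t => Rabs
     ((cosine_sum r n t + - r n * D n t) + r n * D n t))).
  2:{ intros x _; f_equal; ring. }
  apply Rle_trans with (1 := Hcomb (fun t => cosine_sum r n t + - r n * D n t)
    (D n) (r n) Hn (Hdiff n) (HD n)).
  apply Rmult_le_compat_l with (r := r n) in HB; [|lra].
  lra.
Qed.

(** * Numerical value of eta *)

(** Factorials are evaluated in binary, since those up to 25 are out of reach in
    unary. *)
Fixpoint factZ (n : nat) : Z :=
  match n with O => 1%Z | S m => (Z.of_nat (S m) * factZ m)%Z end.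

Lemma INR_fact n : INR (fact n) = IZR (factZ n).
Proof.
  induction n as [|n IH]; [reflexivity|].
  rewrite fact_simpl, mult_INR, IH.
  cbn [factZ]; now rewrite mult_IZR, INR_IZR_INZ.
Qed.

(** Turns partial Taylor sums into explicit expressions with rational coefficients. *)
Ltac expand_taylor :=
  cbn [sum_f_R0 Nat.mul Nat.add]; unfold sin_term; rewrite !INR_fact;
  cbn [sum_f_R0 Nat.mul Nat.add];
  repeat match goal with
  | |- context [factZ ?n] => let v := eval vm_compute in (factZ n) in change (factZ n) with v
  end.

(** The sign of [sin] changes at [PI]; Taylor sums of degree 23 and 25 are precise
    enough to decide the sign at distance less than [1e-8] from it. *)
Lemma PI_bounds : 3.14159265 < PI < 3.14159266.
Proof.
  assert (HPI := PI_RGT_0).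
  assert (HPI4 := PI_4).
  split.
  - assert (H : 0 < sin 3.14159265).
    { apply Rlt_le_trans with (2 := proj1 (pre_sin_bound 3.14159265 5 ltac:(lra) ltac:(lra))).
      unfold sin_approx; expand_taylor; lra. }
    destruct (Rlt_le_dec 3.14159265 PI) as [h|h]; [exact h|].
    assert (H2 : sin 3.14159265 <= 0).
    { apply sin_le_0; [exact h|]. assert (H3 := PI2_3_2); lra. }
    lra.
  - assert (H : sin 3.14159266 < 0).
    { apply Rle_lt_trans with (1 := proj2 (pre_sin_bound 3.14159266 5 ltac:(lra) ltac:(lra))).
      unfold sin_approx; expand_taylor; lra. }
    destruct (Rlt_le_dec PI 3.14159266) as [h|h]; [exact h|].
    assert (H2 : 0 <= sin 3.14159266) by (apply sin_ge_0; lra).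
    lra.
Qed.

(** Terms of the Taylor series of the sine integral. *)
Definition Si_term (x : R) (i : nat) : R :=
  (-1) ^ i * (x ^ (2 * i + 1) / (INR (fact (2 * i + 1)) * INR (2 * i + 1))).

Lemma is_derive_Si_taylor n x :
  is_derive (fun y => sum_f_R0 (Si_term y) n) x
    (sum_f_R0 (fun i => (-1) ^ i * (x ^ (2 * i) / INR (fact (2 * i + 1)))) n).
Proof.
  assert (Hterm : forall i, is_derive (fun y => Si_term y i) x
    ((-1) ^ i * (x ^ (2 * i) / INR (fact (2 * i + 1))))).
  { intros i; unfold Si_term.
    rewrite Nat.add_1_r; set (d := (2 * i)%nat).
    assert (Hf := INR_fact_neq_0 (S d)).
    assert (Hi : INR (S d) <> 0) by (apply not_0_INR; lia).
    set (F := INR (fact (S d))) in *; set (k := INR (S d)) in *; set (e := (-1) ^ i).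
    auto_derive; [exact I|].
    change (e * (1 * (k * x ^ d) * / (F * k)) = e * (x ^ d / F)).
    field; auto. }
  induction n as [|n IH]; [apply Hterm|].
  exact (is_derive_plus _ _ _ _ _ IH (Hterm (S n))).
Qed.

Lemma RInt_sinc_taylor n :
  RInt (fun x => sin_approx x n / x) 0 PI = sum_f_R0 (Si_term PI) n
  /\ ex_RInt (fun x => sin_approx x n / x) 0 PI.
Proof.
  assert (HPI := PI_RGT_0).
  set (b := fun i => / INR (fact (2 * i + 1))).
  set (p := fun x => sum_f_R0 (fun i => (-1) ^ i * (x ^ (2 * i) * b i)) n).
  assert (Heq : forall x, 0 < x -> p x = sin_approx x n / x).
  { intros x Hx; unfold p, sin_approx, Rdiv; rewrite Rmult_comm, scal_sum.
    apply sum_eq; intros i _; unfold sin_term, Rdiv; fold (b i).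
    rewrite pow_add, pow_1; field; lra. }
  assert (Hp : forall x, continuous p x).
  { intros x; apply (ex_derive_continuous (V := R_NormedModule)); unfold p.
    clear; induction n as [|n IH].
    - simpl; auto_derive; exact I.
    - apply (ex_derive_plus (V := R_NormedModule)); [exact IH|].
      auto_derive; exact I. }
  split.
  - rewrite <- (RInt_ext p).
    + rewrite (RInt_of_derive (fun y => sum_f_R0 (Si_term y) n));
        [| intros; apply is_derive_Si_taylor | exact Hp].
      replace (sum_f_R0 (Si_term 0) n) with 0; [real_eq; ring|].
      clear; symmetry; induction n as [|n IH].
      * unfold Si_term; simpl; field.
      * simpl sum_f_R0; rewrite IH; unfold Si_term.
        rewrite pow_i by lia; unfold Rdiv; ring.
    + rewrite Rmin_left, Rmax_right by lra; intros x Hx; apply Heq; lra.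
  - apply (ex_RInt_ext p).
    + rewrite Rmin_left, Rmax_right by lra; intros x Hx; apply Heq; lra.
    + now apply ex_RInt_continuous_everywhere.
Qed.

Lemma ex_RInt_sin_div : ex_RInt (fun x => sin x / x) 0 PI.
Proof.
  assert (HPI := PI_RGT_0).
  apply (ex_RInt_ext sinc).
  - rewrite Rmin_left by lra; intros x Hx; apply sinc_neq0; lra.
  - apply ex_RInt_continuous_everywhere, sinc_continuous.
Qed.

Lemma Si_PI_bounds n :
  sum_f_R0 (Si_term PI) (2 * n + 1) <= RInt (fun x => sin x / x) 0 PI
  <= sum_f_R0 (Si_term PI) (2 * (n + 1)).
Proof.
  assert (HPI := PI_RGT_0).
  destruct (RInt_sinc_taylor (2 * n + 1)) as [<- Hl].
  destruct (RInt_sinc_taylor (2 * (n + 1))) as [<- Hu].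
  assert (Hs := ex_RInt_sin_div).
  split; apply RInt_le; auto; try lra; intros x Hx;
    (apply Rmult_le_compat_r; [left; apply Rinv_0_lt_compat; lra |]);
    apply sin_bound; lra.
Qed.

(** The Taylor sums of degree 15 and 17 at [PI] differ by less than [5e-8]. Multiplied
    by [PI ^ 2], the two inequalities become polynomial in [PI], up to the product of
    [PI] with the sine integral; after that each even power of [PI] is bounded
    separately. *)
Lemma eta_bounds : 2.220884 <= eta < 2.220885.
Proof.
  assert (HPI := PI_bounds).
  destruct (Si_PI_bounds 3) as [Hl Hu].
  unfold eta; set (s := RInt _ 0 PI) in *.
  replace (4 / PI ^ 2 + 2 / PI * (1 + s)) with ((4 + 2 * PI * (1 + s)) / PI ^ 2)
    by (field; lra).
  assert (Hpow : forall k, 3.14159265 ^ k <= PI ^ k <= 3.14159266 ^ k)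
    by (intros k; split; apply pow_incr; lra).
  assert (Hl' : PI * sum_f_R0 (Si_term PI) (2 * 3 + 1) <= PI * s)
    by (apply Rmult_le_compat_l; lra).
  assert (Hu' : PI * s <= PI * sum_f_R0 (Si_term PI) (2 * (3 + 1)))
    by (apply Rmult_le_compat_l; lra).
  clear Hl Hu.
  unfold Si_term in Hl', Hu'; revert Hl' Hu'.
  expand_taylor.
  rewrite !INR_IZR_INZ; cbn [Z.of_nat Pos.of_succ_nat Pos.succ].
  intros Hl Hu.
  assert (H2 := Hpow 2%nat); assert (H4 := Hpow 4%nat); assert (H6 := Hpow 6%nat).
  assert (H8 := Hpow 8%nat); assert (H10 := Hpow 10%nat); assert (H12 := Hpow 12%nat).
  assert (H14 := Hpow 14%nat); assert (H16 := Hpow 16%nat); assert (H18 := Hpow 18%nat).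
  clear Hpow.
  assert (Hsq : 0 < PI ^ 2) by (apply pow_lt; lra).
  split.
  - apply Rmult_le_reg_r with (1 := Hsq).
    unfold Rdiv; rewrite Rmult_assoc, Rinv_l; lra.
  - apply Rmult_lt_reg_r with (1 := Hsq).
    unfold Rdiv; rewrite Rmult_assoc, Rinv_l; lra.
Qed.

(** * The regularized Lebesgue constants *)

Lemma seq_extrema (mu : nat -> R) :
  (forall l, mu l <= mu (S l)) ->
  forall n m, MinRlist (map mu (seq m (S n))) = mu m
    /\ MaxRlist (map mu (seq m (S n))) = mu (m + n)%nat.
Proof.
  intros Hmu.
  assert (Hadd : forall m n, mu m <= mu (m + n)%nat).
  { intros m n; induction n as [|n IH].
    - rewrite Nat.add_0_r; lra.
    - rewrite Nat.add_succ_r; apply Rle_trans with (1 := IH), Hmu. }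
  induction n as [|n IH]; intros m.
  - simpl; now rewrite Nat.add_0_r.
  - destruct (IH (S m)) as [Hmin Hmax].
    change (map mu (seq m (S (S n)))) with (mu m :: mu (S m) :: map mu (seq (S (S m)) n)).
    change (map mu (seq (S m) (S n))) with (mu (S m) :: map mu (seq (S (S m)) n)) in Hmin, Hmax.
    split.
    + change (Rmin (mu m) (MinRlist (mu (S m) :: map mu (seq (S (S m)) n))) = mu m).
      rewrite Hmin; apply Rmin_left, Hmu.
    + change (Rmax (mu m) (MaxRlist (mu (S m) :: map mu (seq (S (S m)) n))) = mu (m + S n)%nat).
      rewrite Hmax; replace (S m + n)%nat with (m + S n)%nat by lia.
      apply Rmax_right, Hadd.
Qed.

Lemma min_mu_eq mu L : (forall l, mu l <= mu (S l)) -> min_mu mu L = mu 0%nat.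
Proof. intros H; exact (proj1 (seq_extrema mu H L 0)). Qed.

Lemma max_mu_eq mu L : (forall l, mu l <= mu (S l)) -> max_mu mu L = mu L.
Proof. intros H; exact (proj2 (seq_extrema mu H L 0)). Qed.

Lemma Lebesgue_constant_eq lambda mu L :
  Lebesgue_constant lambda mu L
  = 2 / PI * RInt (fun t => Rabs (cosine_sum (rho lambda mu) L t)) 0 PI.
Proof.
  unfold Lebesgue_constant, u; change (fun t => Rabs _) with
    (fun t => Rabs (cosine_sum (rho lambda mu) L t)).
  rewrite RInt_even.
  - field; apply PI_neq0.
  - intros x; apply continuous_Rabs_comp, cosine_sum_continuous.
  - intros x; now rewrite cosine_sum_even.
Qed.

Section Regularized.

Variables (lambda : R) (mu : nat -> R).
Hypothesis lambda_ge0 : 0 <= lambda.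
Hypothesis mu0_ge0 : 0 <= mu 0%nat.
Hypothesis mu_nondecreasing : forall l : nat, mu l <= mu (S l).

Lemma mu_monotone l n : (l <= n)%nat -> mu l <= mu n.
Proof.
  induction 1 as [|n _ IH]; [lra|]. apply Rle_trans with (1 := IH); auto.
Qed.

Lemma denominator_ge_1 x : 1 <= 1 + lambda * x ^ 2.
Proof. assert (0 <= lambda * x ^ 2) by (apply Rmult_le_pos; [|apply pow2_ge_0]; auto); lra. Qed.

Lemma rho_bounds l : 0 < rho lambda mu l <= 1.
Proof.
  assert (H := denominator_ge_1 (mu l)); unfold rho; split.
  - apply Rdiv_lt_0_compat; lra.
  - apply Rmult_le_reg_r with (1 + lambda * mu l ^ 2); [lra|].
    unfold Rdiv; rewrite Rmult_assoc, Rinv_l; lra.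
Qed.

Lemma rho_antitone l n : (l <= n)%nat -> rho lambda mu n <= rho lambda mu l.
Proof.
  intros Hln; unfold rho; apply Rmult_le_compat_l; [lra|].
  assert (H := denominator_ge_1 (mu l)).
  assert (H0 := mu_monotone 0 l ltac:(lia)).
  assert (H1 := mu_monotone l n Hln).
  apply Rinv_le_contravar; [lra|].
  apply Rplus_le_compat_l, Rmult_le_compat_l; [exact lambda_ge0|].
  apply pow_incr; lra.
Qed.

Lemma Lebesgue_constant_lower n :
  rho lambda mu n * (4 / PI ^ 2 * ln (INR (S n))) <= Lebesgue_constant lambda mu n.
Proof.
  assert (HPI := PI_RGT_0).
  rewrite Lebesgue_constant_eq.
  assert (H := RInt_Rabs_cosine_sum_ge (rho lambda mu) (rho lambda mu n) n
    (Rlt_le _ _ (proj1 (rho_bounds n))) (fun l => rho_antitone l n)).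
  apply Rmult_le_compat_l with (r := 2 / PI) in H; [|apply Rlt_le, Rdiv_lt_0_compat; lra].
  apply Rle_trans with (2 := H); right; field; lra.
Qed.

(** The pointwise bound produces exactly [eta] for degrees at least 2, the [4 / PI ^ 2]
    in [eta] being the 1 of [1 + 1/2 + ... + 1/(l-1) <= 1 + ln (l-1)]. Degrees 0 and 1
    have no logarithm: [eta] alone bounds them, and [n >= 2] makes [ln (n - 1) >= 0]. *)
Lemma RInt_Rabs_dirichlet_uniform l n :
  (2 <= n)%nat -> (l <= n)%nat ->
  RInt (fun t => Rabs (cosine_sum (fun _ => 1) l t)) 0 PI
  <= PI / 2 * (4 / PI ^ 2 * ln (INR (n - 1)) + eta).
Proof.
  intros Hn Hl.
  assert (HPI := PI_RGT_0).
  assert (Hln : 0 <= 2 / PI * ln (INR (n - 1))).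
  { apply Rmult_le_pos; [apply Rlt_le, Rdiv_lt_0_compat; lra|].
    rewrite <- ln_1; apply ln_le; [lra|]. apply (le_INR 1); lia. }
  assert (H2P : 0 < 2 / PI) by (apply Rdiv_lt_0_compat; lra).
  replace (PI / 2 * (4 / PI ^ 2 * ln (INR (n - 1)) + eta)) with
    (RInt (fun x => sin x / x) 0 PI + 1 + 2 / PI + 2 / PI * ln (INR (n - 1)))
    by (unfold eta; field; lra).
  destruct l as [|[|l]].
  - rewrite (RInt_ext _ (fun _ => / 2)).
    2:{ intros x _; rewrite cosine_sum_0; rewrite Rabs_pos_eq; lra. }
    rewrite RInt_const; unfold scal; simpl; unfold mult; simpl.
    assert (H : PI / 2 * 1 <= PI / 2 * eta)
      by (apply Rmult_le_compat_l; assert (Heta := eta_bounds); lra).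
    replace (PI / 2 * eta) with (2 / PI + (1 + RInt (fun x => sin x / x) 0 PI)) in H
      by (unfold eta; field; lra).
    lra.
  - assert (H := RInt_Rabs_dirichlet_le 0).
    rewrite sum_from_1_to_0 in H; lra.
  - assert (H := RInt_Rabs_dirichlet_le (S l)).
    assert (Hh := harmonic_le_ln l).
    assert (Hm : ln (INR (S l)) <= ln (INR (n - 1))).
    { apply ln_le; [apply lt_0_INR; lia | apply le_INR; lia]. }
    assert (2 / PI * sum_n_m (fun k => / INR k) 1 (S l) <= 2 / PI * (1 + ln (INR (n - 1))))
      by (apply Rmult_le_compat_l; lra).
    lra.
Qed.

Lemma Lebesgue_constant_upper n :
  (2 <= n)%nat ->
  Lebesgue_constant lambda mu n
  <= rho lambda mu 0 * (4 / PI ^ 2 * ln (INR (n - 1)) + eta).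
Proof.
  intros Hn.
  assert (HPI := PI_RGT_0).
  rewrite Lebesgue_constant_eq.
  assert (H := RInt_Rabs_cosine_sum_le (rho lambda mu) n
    (PI / 2 * (4 / PI ^ 2 * ln (INR (n - 1)) + eta))
    (fun l _ => rho_antitone l (S l) (le_S _ _ (le_n l)))
    (Rlt_le _ _ (proj1 (rho_bounds n)))
    (fun l => RInt_Rabs_dirichlet_uniform l n Hn)).
  apply Rmult_le_compat_l with (r := 2 / PI) in H; [|apply Rlt_le, Rdiv_lt_0_compat; lra].
  apply Rle_trans with (1 := H); right; field; lra.
Qed.

(** The map [m |-> q / (1 + lambda m^2)] decreases from [rho 0 * q] to [rho n * q]
    as [m] goes from [mu 0] to [mu n]. It is inverted explicitly, and [lambda > 0] is forced because
    the two end values differ. *)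
Lemma interpolated_parameter q Lam n :
  0 < q -> rho lambda mu n * q <= Lam -> Lam < rho lambda mu 0 * q ->
  {m | mu 0%nat <= m <= mu n /\ q / (1 + lambda * m ^ 2) = Lam}.
Proof.
  intros Hq Hlo Hhi.
  assert (Hrn := rho_bounds n).
  assert (HLam : 0 < Lam) by nra.
  assert (Hmun := mu_monotone 0 n ltac:(lia)).
  assert (Hd0 := denominator_ge_1 (mu 0%nat)).
  assert (Hdn := denominator_ge_1 (mu n)).
  assert (Hlo' : q / Lam <= 1 + lambda * mu n ^ 2).
  { unfold rho in Hlo.
    apply Rmult_le_reg_r with (Lam / (1 + lambda * mu n ^ 2)).
    - apply Rdiv_lt_0_compat; lra.
    - replace (q / Lam * (Lam / (1 + lambda * mu n ^ 2)))
        with (1 / (1 + lambda * mu n ^ 2) * q) by (field; lra).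
      replace ((1 + lambda * mu n ^ 2) * (Lam / (1 + lambda * mu n ^ 2))) with Lam
        by (field; lra).
      exact Hlo. }
  assert (Hhi' : 1 + lambda * mu 0%nat ^ 2 < q / Lam).
  { unfold rho in Hhi.
    apply Rmult_lt_reg_r with (Lam / (1 + lambda * mu 0%nat ^ 2)).
    - apply Rdiv_lt_0_compat; lra.
    - replace (q / Lam * (Lam / (1 + lambda * mu 0%nat ^ 2)))
        with (1 / (1 + lambda * mu 0%nat ^ 2) * q) by (field; lra).
      replace ((1 + lambda * mu 0%nat ^ 2) * (Lam / (1 + lambda * mu 0%nat ^ 2))) with Lam
        by (field; lra).
      exact Hhi. }
  assert (Hlam : 0 < lambda).
  { destruct (Rle_lt_or_eq_dec _ _ lambda_ge0) as [h|h]; [exact h|].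
    rewrite <- h in Hlo', Hhi'; lra. }
  set (w := (q / Lam - 1) / lambda).
  assert (Hw : q / Lam = 1 + lambda * w) by (unfold w; field; lra).
  assert (Hw1 : mu 0%nat ^ 2 <= w <= mu n ^ 2).
  { split; apply Rmult_le_reg_l with lambda; lra. }
  assert (Hw0 : 0 <= w) by (assert (H := pow2_ge_0 (mu 0%nat)); lra).
  exists (sqrt w); split.
  - split.
    + rewrite <- (sqrt_pow2 (mu 0%nat)) by exact mu0_ge0; apply sqrt_le_1_alt; lra.
    + rewrite <- (sqrt_pow2 (mu n)) by lra; apply sqrt_le_1_alt; lra.
  - rewrite pow2_sqrt by exact Hw0; rewrite <- Hw; field; lra.
Qed.

(** If the Lebesgue constant lies in the range of [m |-> q / (1 + lambda m^2)], then
    some [m] makes the error zero. By the lower bound it can only leave that range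
    upwards; then [m = mu 0] is used, and the upper bound limits the error to
    [rho 0 * eta]. The witness is a sigma type so that it can be turned into a
    function of [n] without choice. *)
Lemma effective_parameter n :
  (2 <= n)%nat ->
  {m | mu 0%nat <= m <= mu n /\
    Rabs (Lebesgue_constant lambda mu n
          - 4 / PI ^ 2 * ln (INR n) / (1 + lambda * m ^ 2)) <= eta}.
Proof.
  intros Hn.
  assert (HPI := PI_RGT_0).
  assert (Heta := eta_bounds).
  assert (Hc : 0 < 4 / PI ^ 2) by (apply Rdiv_lt_0_compat; [lra | apply pow_lt; lra]).
  assert (Hn2 : 2 <= INR n) by (apply (le_INR 2); lia).
  assert (Hq : 0 < 4 / PI ^ 2 * ln (INR n)).
  { apply Rmult_lt_0_compat; [exact Hc|]. rewrite <- ln_1; apply ln_increasing; lra. }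
  assert (Hlow := Lebesgue_constant_lower n).
  assert (Hup := Lebesgue_constant_upper n Hn).
  assert (Hmun := mu_monotone 0 n ltac:(lia)).
  destruct (rho_bounds 0) as [Hr0 Hr1]; destruct (rho_bounds n) as [Hrn _].
  set (q := 4 / PI ^ 2 * ln (INR n)) in *.
  destruct (Rle_lt_dec (rho lambda mu 0 * q) (Lebesgue_constant lambda mu n)) as [h|h].
  - exists (mu 0%nat); split; [lra|].
    replace (q / (1 + lambda * mu 0%nat ^ 2)) with (rho lambda mu 0 * q)
      by (unfold rho; field; assert (H := denominator_ge_1 (mu 0%nat)); lra).
    rewrite Rabs_pos_eq by lra.
    assert (Hle : 4 / PI ^ 2 * ln (INR (n - 1)) <= q).
    { apply Rmult_le_compat_l; [lra|]. apply ln_le; [apply lt_0_INR; lia|].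
      apply le_INR; lia. }
    nra.
  - destruct (interpolated_parameter q (Lebesgue_constant lambda mu n) n Hq) as [m [Hm Heq]].
    + apply Rle_trans with (2 := Hlow); apply Rmult_le_compat_l; [lra|].
      apply Rmult_le_compat_l; [lra|]. apply ln_le; [lra|]. apply le_INR; lia.
    + exact h.
    + exists m; split; [exact Hm|]. rewrite Heq, Rminus_diag, Rabs_R0; lra.
Qed.

End Regularized.

Theorem theorem3p1 (f : R -> R) (lambda : R) (mu : nat -> R)
  (f_continuous : continuous_on (fun x => -1 <= x <= 1) f)
  (chebyshev_basis :
     forall L : nat, (2 <= L)%nat -> is_basis_PL L normalized_chebyshevT)
  (lambda_ge0 : 0 <= lambda)
  (mu0_ge0 : 0 <= mu 0%nat)
  (mu_nondecreasing : forall l : nat, mu l <= mu (S l)) :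
  (exists mut : nat -> R,
     (forall L : nat, (2 <= L)%nat -> min_mu mu L <= mut L <= max_mu mu L) /\
     (exists C : R, eventually (fun L : nat =>
        Rabs (Lebesgue_constant lambda mu L
              - 4 / PI ^ 2 * ln (INR L) / (1 + lambda * (mut L) ^ 2)) <= C))) /\
  (forall L : nat, (2 <= L)%nat ->
     Lebesgue_constant lambda mu L
     <= (4 / PI ^ 2 * ln (INR (L - 1)) + eta)
        / (1 + lambda * (min_mu mu L) ^ 2)) /\
  2.220884 <= eta < 2.220885.
Proof.
  split; [|split; [|exact eta_bounds]].
  - pose (m := effective_parameter lambda mu lambda_ge0 mu0_ge0 mu_nondecreasing).
    exists (fun L => match le_dec 2 L with
                     | left HL => proj1_sig (m L HL)
                     | right _ => 0
                     end).
    split; [|exists eta; exists 2%nat]; intros L HL;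
      destruct (le_dec 2 L) as [HL'|]; try contradiction;
      destruct (proj2_sig (m L HL')) as [Hm Hdiff]; [|exact Hdiff].
    now rewrite min_mu_eq, max_mu_eq.
  - intros L HL; rewrite min_mu_eq by exact mu_nondecreasing.
    apply Rle_trans with
      (1 := Lebesgue_constant_upper lambda mu lambda_ge0 mu0_ge0 mu_nondecreasing L HL).
    right; unfold rho, Rdiv; ring.
Qed.
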